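(* Let $n$ be the number of vertices and $k$ the number of parts, with $k=o(n/\log n)$, and let $\alpha=o(\min\{n/k,k\})$. Then any $\alpha$-approximation randomized composable coreset for the maximum matching problem has size $\Omega(n/\alpha^2)$.
   Context: A random $k$-partitioning of the edge set $E$ of a graph $G(V,E)$ assigns each edge independently to one of $k$ sets $E^{(1)},\dots,E^{(k)}$ uniformly at random; $G^{(i)}:=G(V,E^{(i)})$. An algorithm $\mathsf{ALG}$ that, given any graph $H$, outputs a subgraph $\mathsf{ALG}(H)\subseteq H$ with at most $s$ edges is an $\alpha$-approximation randomized composable coreset of size $s$ for maximum matching if, for every graph $G$ and a random $k$-partitioning of $G$, the maximum matching of $\mathsf{ALG}(G^{(1)})\cup\dots\cup\mathsf{ALG}(G^{(k)})$ has size at least $\mathrm{MM}(G)/\alpha$ with high probability over the partitioning, where $\mathrm{MM}(G)$ is the maximum matching size of $G$. *)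

(* Defs.v *)
From HB Require Import structures.
From mathcomp Require Import all_boot all_order all_algebra.
From mathcomp Require Import all_classical all_reals all_analysis.
Set Implicit Arguments.
Unset Strict Implicit.
Unset Printing Implicit Defensive.
Import Order.TTheory GRing.Theory Num.Theory.
Import numFieldNormedType.Exports.
Local Open Scope classical_set_scope.
Local Open Scope ring_scope.

(* A graph on the vertex set V is represented by its set of edges, an edge
   being a two-element set of vertices. *)
Definition simple_graph (V : finType) (E : {set {set V}}) : bool :=
  [forall e in E, #|e| == 2%N].

Definition matching (V : finType) (E M : {set {set V}}) : bool :=
  (M \subset E) && finset.trivIset M.

Definition MM (V : finType) (E : {set {set V}}) : nat :=
  \max_(M : {set {set V}} | matching E M) #|M|.

(* The sample space of the random k-partitioning of E: every edge of E (and
   nothing else) receives one of k labels. *)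
Definition edge_partition (V : finType) (k : nat) (E : {set {set V}}) : finType :=
  {ffun {e : {set V} | e \in E} -> 'I_k}.

Definition part (V : finType) (k : nat) (E : {set {set V}})
    (f : edge_partition k E) (i : 'I_k) : {set {set V}} :=
  [set val e | e : {e : {set V} | e \in E} & f e == i]%SET.

(* Independent uniform labels make all k ^ #|E| labellings equally likely, so
   the probability of an event is its proportion of labellings. *)
Definition Pr_partition (R : realType) (V : finType) (k : nat)
    (E : {set {set V}}) (A : pred (edge_partition k E)) : R :=
  #|[set f | A f]%SET|%:R / #|edge_partition k E|%:R.

(* One map on the graphs with vertex set 'I_n for each n; its values outside
   simple graphs are irrelevant. *)
Definition graph_algorithm : Type :=
  forall n : nat, {set {set 'I_n}} -> {set {set 'I_n}}.

Definition coreset_union (ALG : graph_algorithm) (n k : nat)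
    (E : {set {set 'I_n}}) (f : edge_partition k E) : {set {set 'I_n}} :=
  (\bigcup_(i < k) ALG n (part f i))%SET.

(* The number of parts k, the ratio alpha and the size s depend on the number
   of vertices n. "With high probability" means with probability 1 - o(1) as n
   tends to infinity, uniformly over the graphs with n vertices. *)
Definition randomized_composable_coreset (R : realType) (k : nat -> nat)
    (alpha : nat -> R) (s : nat -> nat) (ALG : graph_algorithm) : Prop :=
  (forall (n : nat) (E : {set {set 'I_n}}), simple_graph E ->
     (ALG n E \subset E) && (#|ALG n E| <= s n)%N) /\
  (forall eps : R, 0 < eps ->
     \forall n \near \oo, forall E : {set {set 'I_n}}, simple_graph E ->
       1 - eps <= Pr_partition R (fun f : edge_partition (k n) E =>
         (MM E)%:R / alpha n <= (MM (coreset_union ALG f))%:R)).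

(* Main.v *)
(* G consists of a hidden matching H of about n/4 edges and of M, about n/(32 alpha k),
   disjoint copies of K_{k,k}, with its vertices permuted at random. In every part
   the copies of K_{k,k} leave of the order of Mk, that is n/alpha, isolated edges,
   which the algorithm cannot tell apart from the hidden edges of that part: the
   transposition of two isolated edges preserves the part. So a coreset of size s
   contains on average at most s h_i / N_i of the h_i hidden edges of part i, where
   N_i is the number of isolated edges of the part, and the k coresets
   together contain O(s alpha) hidden edges. Every matching has at most Mk edges outside
   H, so an alpha-approximation must keep of the order of n/alpha hidden edges, and
   s alpha is at least of the order of n/alpha. *)
Require Import Defs.
From mathcomp Require Import all_boot all_order all_algebra all_fingroup.
From mathcomp Require Import reals ring lra zify.
Set Implicit Arguments.
Unset Strict Implicit.
Unset Printing Implicit Defensive.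
Import Order.TTheory GRing.Theory Num.Theory.
Local Open Scope ring_scope.

(** * Isolated cells under a random coloring: first two moments and concentration *)

(** Independence of the colors in counting form: the admissible colorings form a [family] with one
    choice at each point of A, k - 1 at each point of B and k elsewhere, and dividing each factor by
    k gives the right-hand side. *)
Lemma sum_prescribed (R : realFieldType) (T : finType) (k : nat) (i : 'I_k)
    (A B : {set T}) : [disjoint A & B] ->
  \sum_(g : {ffun T -> 'I_k})
     ([forall x in A, g x == i] && [forall x in B, g x != i])%:R =
  #|{ffun T -> 'I_k}|%:R * (k%:R^-1 ^+ #|A| * (1 - k%:R^-1) ^+ #|B|) :> R.
Proof.
move=> dAB.
have k0 : k%:R != 0 :> R by rewrite pnatr_eq0 -lt0n; case: i => j /(leq_ltn_trans (leq0n _)).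
pose F x : pred 'I_k := fun j => ((x \in A) ==> (j == i)) && ((x \in B) ==> (j != i)).
transitivity (#|family F|%:R : R).
  rewrite -sum1_card natr_sum [RHS]big_mkcond /=; apply: eq_bigr => g _.
  have -> : (g \in family F) = [forall x in A, g x == i] && [forall x in B, g x != i].
    apply/familyP/andP => [gF|[/forall_inP gA /forall_inP gB] x].
      split; apply/forall_inP => x xA; have := gF x; rewrite unfold_in xA /=.
        by case/andP.
      by case/andP.
    rewrite unfold_in; apply/andP; split; apply/implyP => xA; [exact: gA | exact: gB].
  by case: (_ && _).
rewrite card_family card_ffun card_ord natrX -!prodr_const.
rewrite foldrE big_map big_enum /= natr_prod.
rewrite [X in _ = _ * (X * _)]big_mkcond [X in _ = _ * (_ * X)]big_mkcond -!big_split /=.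
apply: eq_bigr => x _.
have cF (P : pred 'I_k) : P =1 F x -> #|F x| = #|P|
  by move=> e; apply: eq_card => j; rewrite !unfold_in e.
case: ifPn => [xA|xA].
  rewrite (disjointFr dAB xA) (cF (pred1 i)) ?card1 ?mulr1 ?divff // => j.
  by rewrite /F /= xA (disjointFr dAB xA) andbT.
case: ifPn => [xB|xB].
  have -> : #|F x| = k.-1.
    rewrite (cF (predC1 i)); first by rewrite cardC1 card_ord.
    by move=> j; rewrite /F /= (negPf xA) xB.
  rewrite mul1r mulrBr mulr1 divff // -subn1 natrB //.
  by case: (i) => j /(leq_ltn_trans (leq0n _)).
rewrite !mulr1 (cF predT) ?card_ord // => j.
by rewrite /F /= (negPf xA) (negPf xB).
Qed.

(* The cell (j, x, y) stands for the edge xy of the j-th copy of K_{k,k}. *)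
Definition cell_adj (M k : nat) (u v : 'I_M * 'I_k * 'I_k) : bool :=
  (u.1.1 == v.1.1) && ((u.1.2 == v.1.2) (+) (u.2 == v.2)).

Lemma cell_adjC (M k : nat) (u v : 'I_M * 'I_k * 'I_k) : cell_adj u v = cell_adj v u.
Proof. by rewrite /cell_adj ![_ == v.1.1]eq_sym [u.1.2 == _]eq_sym [u.2 == _]eq_sym. Qed.

Lemma cell_adjxx (M k : nat) (u : 'I_M * 'I_k * 'I_k) : cell_adj u u = false.
Proof. by rewrite /cell_adj !eqxx. Qed.

(** Only conflicts with other cells are tested. The colored set T is left abstract; it is later the
    set of all vertex sets, with [phi] embedding the cells. *)
Definition lone (M k l : nat) (T : finType) (phi : 'I_M * 'I_k * 'I_k -> T)
    (i : 'I_l) (g : {ffun T -> 'I_l}) (u : 'I_M * 'I_k * 'I_k) : bool :=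
  (g (phi u) == i) && [forall v, cell_adj u v ==> (g (phi v) != i)].

Lemma card_cell_adj (M k : nat) (u : 'I_M * 'I_k * 'I_k) :
  #|[set v | cell_adj u v]| = (2 * k.-1)%N.
Proof.
case: u => [[j x] y].
have -> : [set v | cell_adj (j, x, y) v] =
    [set (j, x, y') | y' in [set~ y]] :|: [set (j, x', y) | x' in [set~ x]].
  apply/setP => -[[j' x'] y']; rewrite !inE /cell_adj /=.
  apply/andP/orP => [[/eqP <-]|].
    case: eqVneq => [<-|xx'] /=; case: eqVneq => [<-|yy'] //= _.
      by left; apply/imsetP; exists y' => //; rewrite !inE eq_sym.
    by right; apply/imsetP; exists x' => //; rewrite !inE eq_sym.
  by case=> /imsetP[z]; rewrite !inE => zN [-> -> ->]; rewrite !eqxx eq_sym (negPf zN).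
rewrite cardsU !card_imset; [|by move=> ? ? []..].
rewrite (_ : _ :&: _ = set0) ?cards0 ?subn0 ?cardsC1 ?card_ord; first by lia.
apply/setP => v; rewrite !inE; apply/negP => /andP[/imsetP[z]].
by rewrite !inE => zN -> /imsetP[w _ [_ /eqP]]; rewrite (negPf zN).
Qed.

(** Inclusion-exclusion: two vertex-disjoint edges xy and x'y' of one copy have at most the common
    neighbours xy' and x'y, and cells of different copies have none. *)
Lemma card_cell_adjU (M k : nat) (u v : 'I_M * 'I_k * 'I_k) :
    ~~ cell_adj u v -> u != v ->
  (4 * k.-1 - (u.1.1 == v.1.1) * 2 <=
     #|[set w | cell_adj u w] :|: [set w | cell_adj v w]|)%N.
Proof.
move=> uvA uv; rewrite cardsU !card_cell_adj -mulnDl leq_sub2l //.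
case: u v uv uvA => [[j x] y] [[j' x'] y']; rewrite /cell_adj /=.
case: (eqVneq j j') => [<-|jj'] /=.
  move=> uv uvA; apply: leq_trans (subset_leq_card (_ : _ \subset [set (j, x, y'); (j, x', y)])) _.
    apply/subsetP => -[[a b] c]; rewrite !inE /cell_adj /=.
    case/andP => /andP[/eqP <- e1] /andP[_ e2].
    move: uv uvA e1 e2; rewrite !xpair_eqE !eqxx /=.
    case: (eqVneq x x'); case: (eqVneq y y') => //= yy' xx' _ _.
    case: (eqVneq x b) => [<-|xb]; case: (eqVneq y c) => [<-|yc] //= _.
      by rewrite eq_sym (negPf xx') /= eq_sym => ->.
    by rewrite [y' == y]eq_sym (negPf yy') addbF => /eqP <-; rewrite eqxx.
  by rewrite cards2; case: (_ != _).
move=> _ _; rewrite leqn0 cards_eq0; apply/eqP/setP => -[[a b] c].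
rewrite !inE /cell_adj /=; apply/negP => /andP[/andP[/eqP ja _] /andP[/eqP ja' _]].
by rewrite ja ja' eqxx in jj'.
Qed.

Lemma sum_lone (R : realFieldType) (M k : nat) (T : finType)
    (phi : 'I_M * 'I_k * 'I_k -> T) (i : 'I_k) (u : 'I_M * 'I_k * 'I_k) :
  injective phi ->
  \sum_(g : {ffun T -> 'I_k}) (lone phi i g u)%:R =
  #|{ffun T -> 'I_k}|%:R * (k%:R^-1 * (1 - k%:R^-1) ^+ (2 * k.-1)) :> R.
Proof.
move=> phi_inj.
have dAB : [disjoint [set phi u] & phi @: [set v | cell_adj u v]].
  by rewrite disjoints1 mem_imset // inE cell_adjxx.
have := sum_prescribed R i dAB; rewrite cards1 card_imset // card_cell_adj expr1 => <-.
apply: eq_bigr => g _; congr ((nat_of_bool _)%:R).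
rewrite /lone; congr (_ && _).
  by apply/idP/forall_inP => [gu x|->]; rewrite ?inE // => /eqP ->.
apply/forallP/forall_inP => [gA x /imsetP[v]|gA v].
  by rewrite inE => uv ->; apply: (implyP (gA v)).
by apply/implyP => uv; apply: gA; apply: imset_f; rewrite inE.
Qed.

(** Adjacent cells are never both lone. For nonadjacent ones the event prescribes color i at two
    points and forbids it on the union of the two neighbourhoods; since 1 - 1/k lies in [0, 1], a
    lower bound on the size of that union bounds the probability from above. *)
Lemma sum_lone2 (R : realFieldType) (M k : nat) (T : finType)
    (phi : 'I_M * 'I_k * 'I_k -> T) (i : 'I_k) (u v : 'I_M * 'I_k * 'I_k) :
  injective phi -> u != v ->
  \sum_(g : {ffun T -> 'I_k}) (lone phi i g u && lone phi i g v)%:R <=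
  #|{ffun T -> 'I_k}|%:R * ((~~ cell_adj u v)%:R * (k%:R^-1 ^+ 2 *
      (1 - k%:R^-1) ^+ (4 * k.-1 - (u.1.1 == v.1.1) * 2))) :> R.
Proof.
move=> phi_inj uv; have [uvA|uvA] := boolP (cell_adj u v).
  rewrite mul0r mulr0 big1 // => g _; rewrite (_ : _ && _ = false) //.
  apply/negP => /andP[/andP[_ /forallP /(_ v)]]; rewrite uvA /= => gv /andP[].
  by rewrite (negPf gv).
rewrite mul1r.
have p01 : 0 <= 1 - (k%:R^-1 : R) <= 1.
  have k1 : 1 <= k%:R :> R by rewrite ler1n; case: i => j /(leq_ltn_trans (leq0n _)).
  have := invf_le1 (lt_le_trans ltr01 k1); rewrite k1 => kV.
  by rewrite subr_ge0 kV gerBl invr_ge0 ler0n.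
have dAB : [disjoint [set phi u; phi v] &
                     phi @: ([set w | cell_adj u w] :|: [set w | cell_adj v w])].
  rewrite -setI_eq0; apply/eqP/setP => x; rewrite !inE; apply/negP.
  by case/andP => /orP[] /eqP ->; rewrite mem_imset // !inE cell_adjxx
    ?[cell_adj v u]cell_adjC (negPf uvA).
have := sum_prescribed R i dAB.
rewrite cards2 (inj_eq phi_inj) uv card_imset // => P.
apply: le_trans (_ : #|{ffun T -> 'I_k}|%:R * (k%:R^-1 ^+ 2 * (1 - k%:R^-1) ^+
    #|[set w | cell_adj u w] :|: [set w | cell_adj v w]|) <= _); last first.
  apply: ler_wpM2l => //; apply: ler_wpM2l; first by rewrite exprn_ge0 // invr_ge0.
  have := card_cell_adjU uvA uv; apply: ler_wiXn2l; by case/andP: p01.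
rewrite -P; apply: ler_sum => g _; rewrite ler_nat.
case: (boolP (lone _ _ _ u && _)) => // /andP[/andP[gu /forallP gAu] /andP[gv /forallP gAv]].
rewrite lt0b; apply/andP; split; apply/forall_inP => x.
  by rewrite !inE => /orP[] /eqP ->.
case/imsetP => w; rewrite !inE => /orP[] uw ->.
  exact: (implyP (gAu w)).
exact: (implyP (gAv w)).
Qed.

Lemma natr_card_set (R : pzSemiRingType) (T : finType) (P : pred T) :
  #|[set x | P x]|%:R = \sum_x (P x)%:R :> R.
Proof. by rewrite -sum1dep_card natr_sum big_mkcond; apply: eq_bigr => x _; case: ifP. Qed.

(* With p = 1/k and q = p (1-p)^(2k-2), the (k-1)^2 vertex-disjoint cells in the block
   of u contribute (k-1)^2 p^2 (1-p)^(4k-6) = k^2 q^2, exactly as much as the k^2 cells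
   of any other block; this is why the variance in [sum_card_lone2] is at most the mean. *)
Lemma sum_nonadjacent_le (R : realFieldType) (M k : nat) (u : 'I_M * 'I_k * 'I_k)
    (p := k%:R^-1 : R) :
  \sum_(v | v != u) (~~ cell_adj u v)%:R *
     (p ^+ 2 * (1 - p) ^+ (4 * k.-1 - (u.1.1 == v.1.1) * 2)) <=
  M%:R * ((1 - p) ^+ (2 * k.-1)) ^+ 2.
Proof.
case: u => [[j x] y].
have k_gt0 : (0 < k)%N by case: (x) => z /(leq_ltn_trans (leq0n _)).
have kp : k%:R * p = 1 by rewrite divff // pnatr_eq0 -lt0n.
have p_ge0 : 0 <= p by rewrite invr_ge0.
have q_ge0 : 0 <= 1 - p by rewrite subr_ge0 invf_le1 ?ltr0n ?ler1n.
(* In the block of u a cell that is neither u nor adjacent to u differs from u in both coordinates;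
   in other blocks nothing is required. In this form the sum factors over the three coordinates. *)
pose F (j' : 'I_M) (x' y' : 'I_k) : R :=
  ((j == j') ==> (x != x') && (y != y'))%:R *
     (p ^+ 2 * (1 - p) ^+ (4 * k.-1 - (j == j') * 2)).
apply: (@le_trans _ _ (\sum_v F v.1.1 v.1.2 v.2)).
  rewrite big_mkcond; apply: ler_sum => -[[j' x'] y'] _; rewrite /F /=.
  have t_ge0 l : 0 <= p ^+ 2 * (1 - p) ^+ l by rewrite mulr_ge0 ?exprn_ge0.
  case: ifPn => [uv|_]; last by rewrite mulr_ge0.
  apply: ler_wpM2r; first exact: t_ge0.
  rewrite ler_nat; move: uv; rewrite /cell_adj /= !xpair_eqE.
  rewrite [j' == j]eq_sym [x' == x]eq_sym [y' == y]eq_sym.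
  by case: (j == j'); case: (x == x'); case: (y == y').
rewrite -(pair_bigA _ (fun v y' => F v.1 v.2 y')) /=.
rewrite -(pair_bigA _ (fun j' x' => \sum_y' F j' x' y')) /=.
rewrite mulr_natl -[M in _ *+ M]card_ord -sumr_const; apply: ler_sum => j' _.
rewrite -exprM; case: (eqVneq j j') => [jj'|jj']; last first.
  rewrite (eq_bigr (fun=> p * (1 - p) ^+ (4 * k.-1))); last first.
    move=> x' _; rewrite (eq_bigr (fun=> p ^+ 2 * (1 - p) ^+ (4 * k.-1))); last first.
      by move=> y' _; rewrite /F (negPf jj') /= mul1r mul0n subn0.
    by rewrite sumr_const card_ord -mulr_natl mulrA expr2 mulrA kp mul1r.
  rewrite sumr_const card_ord -mulr_natl mulrA kp mul1r.
  by rewrite (_ : (4 * _ = 2 * k.-1 * 2)%N) //; lia.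
pose r := (1 - p) ^+ (4 * k.-1 - 2).
have C1 (z : 'I_k) (c : R) : \sum_z' (z != z')%:R * c = k.-1%:R * c.
  rewrite -mulr_suml; congr (_ * _).
  rewrite -natr_card_set; congr (_%:R).
  rewrite -[k in RHS]card_ord -(cardsC1 z).
  by apply: eq_card => z'; rewrite !inE eq_sym.
rewrite (eq_bigr (fun x' => (x != x')%:R * (k.-1%:R * (p ^+ 2 * r)))); last first.
  move=> x' _; rewrite -(C1 y) mulr_sumr; apply: eq_bigr => y' _.
  by rewrite /F jj' eqxx /= mul1n -/r -mulnb natrM -mulrA.
rewrite C1 (_ : k.-1%:R = k%:R - 1); last by rewrite -subn1 natrB.
have -> : (k%:R - 1) * ((k%:R - 1) * (p ^+ 2 * r)) = (k%:R * p - p) ^+ 2 * r by ring.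
(* For k = 1 the truncated exponent 4 (k - 1) - 2 is 0 instead of -2, but then p = 1 and the left
   side vanishes. *)
rewrite kp; case: (leqP k 1) => [k1|k1].
  rewrite (_ : p = 1) ?subrr ?expr0n ?mul0r ?exprn_ge0 //.
  by rewrite /p (_ : k = 1%N) ?invr1 //; lia.
have -> : ((2 * k.-1) * 2 = 2 + (4 * k.-1 - 2))%N by lia.
by rewrite exprD.
Qed.

Lemma sum_card_lone (R : realFieldType) (M k : nat) (T : finType)
    (phi : 'I_M * 'I_k * 'I_k -> T) (i : 'I_k) (p := k%:R^-1 : R) :
  injective phi ->
  \sum_(g : {ffun T -> 'I_k}) #|[set u | lone phi i g u]|%:R =
  #|{ffun T -> 'I_k}|%:R * ((M * k)%:R * (1 - p) ^+ (2 * k.-1)) :> R.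
Proof.
move=> phi_inj.
have k_gt0 : (0 < k)%N by case: (i) => z /(leq_ltn_trans (leq0n _)).
have kp : k%:R * p = 1 by rewrite divff // pnatr_eq0 -lt0n.
rewrite (eq_bigr _ (fun g _ => natr_card_set R (lone phi i g))).
rewrite exchange_big /= (eq_bigr _ (fun u _ => sum_lone R i u phi_inj)).
rewrite sumr_const !card_prod !card_ord -[LHS]mulr_natr !natrM -/p.
set w := _%:R; set r := _ ^+ _.
by transitivity (w * (M%:R * k%:R * (k%:R * p) * r)); [ring | rewrite kp mulr1].
Qed.

(** Expanding the square over pairs of cells, the diagonal contributes the mean and the other pairs
    at most its square, so the variance is at most mu. *)
Lemma sum_card_lone2 (R : realFieldType) (M k : nat) (T : finType)
    (phi : 'I_M * 'I_k * 'I_k -> T) (i : 'I_k) (p := k%:R^-1 : R)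
    (mu := (M * k)%:R * (1 - p) ^+ (2 * k.-1) : R) :
  injective phi ->
  \sum_(g : {ffun T -> 'I_k}) #|[set u | lone phi i g u]|%:R ^+ 2 <=
  #|{ffun T -> 'I_k}|%:R * (mu + mu ^+ 2).
Proof.
move=> phi_inj.
have k_gt0 : (0 < k)%N by case: (i) => z /(leq_ltn_trans (leq0n _)).
have kp : k%:R * p = 1 by rewrite divff // pnatr_eq0 -lt0n.
pose r := (1 - p) ^+ (2 * k.-1).
rewrite (eq_bigr (fun g => \sum_u \sum_v (lone phi i g u && lone phi i g v)%:R)); last first.
  move=> g _; rewrite natr_card_set expr2 mulr_suml; apply: eq_bigr => u _.
  by rewrite mulr_sumr; apply: eq_bigr => v _; rewrite -natrM mulnb.
rewrite exchange_big /=.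
apply: (@le_trans _ _ (\sum_(u : 'I_M * 'I_k * 'I_k)
    #|{ffun T -> 'I_k}|%:R * (p * r + M%:R * r ^+ 2))); last first.
  rewrite sumr_const !card_prod !card_ord -[leLHS]mulr_natl /mu -/r !natrM.
  rewrite le_eqVlt; apply/orP; left; apply/eqP.
  transitivity (#|{ffun T -> 'I_k}|%:R *
      (M%:R * k%:R * (k%:R * p) * r + (M%:R * k%:R * r) ^+ 2)); first by ring.
  by rewrite kp mulr1.
apply: ler_sum => u _; rewrite exchange_big /= (bigD1 u) //= mulrDr; apply: lerD.
  rewrite -(sum_lone R i u phi_inj); apply: ler_sum => g _.
  by rewrite andbb.
apply: le_trans (ler_wpM2l (ler0n _ _) (sum_nonadjacent_le R u)).
rewrite mulr_sumr; apply: ler_sum => v vu; apply: sum_lone2 => //.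
by rewrite eq_sym.
Qed.

(** Chebyshev's inequality for a deviation of mu / 2 and a variance of at most mu. *)
Lemma card_lone_chebyshev (R : realFieldType) (M k : nat) (T : finType)
    (phi : 'I_M * 'I_k * 'I_k -> T) (i : 'I_k) (p := k%:R^-1 : R)
    (mu := (M * k)%:R * (1 - p) ^+ (2 * k.-1) : R) :
  injective phi -> 0 < mu ->
  \sum_(g : {ffun T -> 'I_k}) (#|[set u | lone phi i g u]|%:R < mu / 2)%R%:R <=
  #|{ffun T -> 'I_k}|%:R * (4 / mu).
Proof.
move=> phi_inj mu_gt0.
have h : \sum_(g : {ffun T -> 'I_k})
      (#|[set u | lone phi i g u]|%:R < mu / 2)%R%:R * (mu / 2) ^+ 2 <=
    \sum_(g : {ffun T -> 'I_k}) (#|[set u | lone phi i g u]|%:R - mu) ^+ 2.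
  apply: ler_sum => g _; case: ltP => [tmu|_]; last by rewrite mul0r sqr_ge0.
  by rewrite mul1r -[leRHS]sqrrN ler_sqr ?nnegrE; lra.
rewrite -mulr_suml in h.
have e : \sum_(g : {ffun T -> 'I_k}) (#|[set u | lone phi i g u]|%:R - mu) ^+ 2 <=
    #|{ffun T -> 'I_k}|%:R * mu.
  rewrite (eq_bigr (fun g : {ffun T -> 'I_k} => #|[set u | lone phi i g u]|%:R ^+ 2 +
     (- (2 * mu) * #|[set u | lone phi i g u]|%:R + mu ^+ 2))); last by move=> g _; ring.
  rewrite !big_split /= -mulr_sumr sumr_const sum_card_lone // -/p -/mu -mulr_natl.
  have := sum_card_lone2 R i phi_inj; rewrite -/p -/mu; lra.
have := le_trans h e.
rewrite -ler_pdivlMr ?exprn_gt0 ?divr_gt0 //.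
by congr (_ <= _); field; rewrite gt_eqF.
Qed.

(** * Random relabellings and the symmetry between isolated edges *)

Definition relabel (V : finType) (sigma : {perm V}) (G : {set {set V}}) : {set {set V}} :=
  [set sigma @: e | e : {set V} in G].

Definition isolated_edges (V : finType) (G : {set {set V}}) : {set {set V}} :=
  [set e in G | (#|e| == 2%N) && [forall e' in G, (e' != e) ==> [disjoint e & e']]].

Lemma imset_permM (V : finType) (s t : {perm V}) (e : {set V}) :
  (s * t)%g @: e = t @: (s @: e).
Proof. by rewrite -imset_comp; apply: eq_imset => x; rewrite permM. Qed.

Lemma relabelM (V : finType) (s t : {perm V}) (G : {set {set V}}) :
  relabel (s * t)%g G = relabel t (relabel s G).
Proof. by rewrite /relabel -imset_comp; apply: eq_imset => e /=; rewrite imset_permM. Qed.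

Lemma imset_perm_inj (V : finType) (s : {perm V}) : injective (fun e : {set V} => s @: e).
Proof. exact/imset_inj/perm_inj. Qed.

Lemma card_relabel (V : finType) (s : {perm V}) (G : {set {set V}}) : #|relabel s G| = #|G|.
Proof. exact/card_imset/imset_perm_inj. Qed.

(** For e = ab and e' = cd, the product of the transpositions of a, c and of b, d exchanges the two
    edges and fixes every other edge of G pointwise, because those edges avoid all four vertices. *)
Lemma isolated_edges_swap (V : finType) (G : {set {set V}}) (e e' : {set V}) :
  e \in isolated_edges G -> e' \in isolated_edges G ->
  exists2 s : {perm V}, s @: e = e' & relabel s G = G.
Proof.
have [<- eI _|ee'] := eqVneq e e'.
  exists 1%g; first by rewrite (eq_imset _ (@perm1 V)) imset_id.
  rewrite /relabel -[RHS]imset_id; apply: eq_imset => x.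
  by rewrite (eq_imset _ (@perm1 V)) imset_id.
rewrite !inE => /and3P[eG /cards2P[a [b [ab eE]]] /forall_inP eiso].
case/and3P => e'G /cards2P[c [d [cd e'E]]] /forall_inP e'iso.
have dee' : [disjoint e & e'] by apply: (implyP (eiso _ e'G)); rewrite eq_sym.
have nin z : z \in e -> z \in e' -> False by move=> ze; rewrite (disjointFr dee' ze).
have neq x y : x \in e -> y \in e' -> (x != y) * (y != x).
  by move=> xe ye; rewrite [y == x]eq_sym; case: eqVneq => // xy; case: (nin x); rewrite // xy.
have [ae be] : a \in e /\ b \in e by rewrite eE !inE !eqxx orbT.
have [ce de] : c \in e' /\ d \in e' by rewrite e'E !inE !eqxx orbT.
pose s := (tperm a c * tperm b d)%g.
have sa : s a = c by rewrite permM tpermL tpermD // ?(neq _ _ be ce) // eq_sym.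
have sb : s b = d by rewrite permM [tperm a c b]tpermD ?tpermL // ?(neq _ _ be ce).
have sc : s c = a by rewrite permM tpermR tpermD // 1?eq_sym // (neq _ _ ae de).
have sd : s d = b by rewrite permM [tperm a c d]tpermD ?tpermR // ?(neq _ _ ae de).
have see' : s @: e = e' by rewrite eE e'E imsetU !imset_set1 sa sb.
have se'e : s @: e' = e by rewrite eE e'E imsetU !imset_set1 sc sd.
(* Relabelling preserves the number of edges, so one inclusion suffices. *)
exists s => //; apply/eqP; rewrite eqEcard card_relabel leqnn andbT.
apply/subsetP => y /imsetP[x xG ->{y}].
have [->|xe] := eqVneq x e; first by rewrite see'.
have [->|xe'] := eqVneq x e'; first by rewrite se'e.
have dex := implyP (eiso _ xG) xe; have de'x := implyP (e'iso _ xG) xe'.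
rewrite (_ : s @: x = x) // -[RHS]imset_id; apply: eq_in_imset => z zx.
have zne y : y \in e -> y != z.
  by move=> ye; apply: contraTneq zx => <-; rewrite (disjointFr dex ye).
have zne' y : y \in e' -> y != z.
  by move=> ye; apply: contraTneq zx => <-; rewrite (disjointFr de'x ye).
by rewrite permM (tpermD (zne a ae) (zne' c ce)) (tpermD (zne b be) (zne' d de)).
Qed.

(* Swapping two isolated edges preserves G, so all of them are selected equally often;
   hence the hidden ones get a share #|H| / #|isolated_edges G| of the s slots. *)
Lemma sum_selected_isolated (V : finType) (alg : {set {set V}} -> {set {set V}})
    (G H : {set {set V}}) (s : nat) :
    (forall sigma : {perm V}, #|alg (relabel sigma G)| <= s)%N ->
    H \subset isolated_edges G ->
  (#|isolated_edges G| *
     \sum_(sigma : {perm V}) #|[set e in H | sigma @: e \in alg (relabel sigma G)]|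
   <= #|H| * (s * #|{perm V}|))%N.
Proof.
move=> alg_s HI.
pose w (e : {set V}) := (\sum_(sigma : {perm V}) (sigma @: e \in alg (relabel sigma G)))%N.
have wE (A : {set {set V}}) :
    (\sum_(sigma : {perm V}) #|[set e in A | sigma @: e \in alg (relabel sigma G)]| =
       \sum_(e in A) w e)%N.
  rewrite exchange_big /=; apply: eq_bigr => sigma _.
  by rewrite -sum1dep_card -big_mkcondr.
have w_const e e' : e \in isolated_edges G -> e' \in isolated_edges G -> w e = w e'.
  move=> eI e'I; have [t te tG] := isolated_edges_swap eI e'I.
  (* Translating sigma by t permutes the group; as t fixes G, the algorithm sees the same graph
     while the tracked edge moves from e to e'. *)
  rewrite /w (reindex_inj (mulgI t)); apply: eq_bigr => sigma _.
  by rewrite relabelM imset_permM te tG.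
rewrite wE; have [H0|[e0 e0H]] := set_0Vmem H; first by rewrite H0 big_set0 muln0.
have e0I := subsetP HI _ e0H.
rewrite (eq_bigr (fun=> w e0)); last by move=> e eH; apply: w_const => //; apply: (subsetP HI).
rewrite sum_nat_const mulnCA leq_mul2l; apply/orP; right.
rewrite -sum_nat_const (eq_bigr w); last by move=> e eI; apply: w_const.
(* Summed over all isolated edges, w counts distinct selected edges, hence at most s for each
   sigma. *)
rewrite -wE mulnC -sum_nat_const; apply: leq_sum => sigma _.
apply: leq_trans (alg_s sigma).
rewrite -(card_imset _ (@imset_perm_inj _ sigma)); apply: subset_leq_card.
by apply/subsetP => y /imsetP[e eA ->{y}]; move: eA; rewrite inE => /andP[].
Qed.

(** * The hard graph: copies of K_{k,k} and a hidden matching *)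

(* phi lists the edges of the copies of K_{k,k}, H is the hidden matching and C is one
   side of the copies, a vertex cover of their edges. *)
Record hard_template (V : finType) (M k m : nat)
    (phi : 'I_M * 'I_k * 'I_k -> {set V}) (H : {set {set V}}) (C : {set V}) : Prop := HardTemplate {
  cell_inj : injective phi;
  card_cell : forall u, #|phi u| = 2%N;
  cell_disjoint : forall u v, u != v -> ~~ cell_adj u v -> [disjoint phi u & phi v];
  card_cover : (#|C| <= M * k)%N;
  cell_cover : forall u, ~~ [disjoint phi u & C];
  card_hidden : #|H| = m;
  card_hidden_edge : forall e, e \in H -> #|e| = 2%N;
  hidden_disjoint : forall e e', e \in H -> e' \in H -> e != e' -> [disjoint e & e'];
  hidden_cell_disjoint : forall e u, e \in H -> [disjoint e & phi u] }.

Lemma disjoint_set2 (T : finType) (a b c d : T) :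
  [disjoint [set a; b] & [set c; d]] = [&& a != c, a != d, b != c & b != d].
Proof.
rewrite disjoint_sym disjoints_subset subUset !sub1set !inE !negb_or.
by rewrite [c == a]eq_sym [c == b]eq_sym [d == a]eq_sym [d == b]eq_sym; do 4 case: (_ == _).
Qed.

Lemma injection_of_card_leq (A B : finType) : (#|A| <= #|B|)%N -> exists f : A -> B, injective f.
Proof.
move=> AB; exists (fun x => enum_val (widen_ord AB (enum_rank x))) => x y.
by move/enum_val_inj/(congr1 val) => /= xy; apply/enum_rank_inj/val_inj.
Qed.

(** The copies take 2Mk vertices and the hidden edges 2m. The Boolean tag is the side of a copy or
    the endpoint of a hidden edge, and the cover C consists of the sides tagged [false]. *)
Lemma hard_template_exists (V : finType) (M k m : nat) :
  (2 * (M * k) + 2 * m <= #|V|)%N ->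
  exists phi H C, @hard_template V M k m phi H C.
Proof.
move=> V_large.
have [|f f_inj] := @injection_of_card_leq ('I_M * 'I_k * bool + 'I_m * bool)%type V.
  by rewrite card_sum !card_prod !card_ord card_bool ![(_ * 2)%N]mulnC.
pose phi (u : 'I_M * 'I_k * 'I_k) := [set f (inl (u.1, false)); f (inl (u.1.1, u.2, true))].
pose h t := [set f (inr (t, false)); f (inr (t, true))].
have feq := inj_eq f_inj.
have h_disj t t' : t != t' -> [disjoint h t & h t'].
  by move=> tt'; rewrite disjoint_set2 !feq /eq_op /= /eq_op /= (negPf tt').
have h_inj : injective h.
  move=> t t' htt'; apply/eqP; apply/negPn/negP => /h_disj; rewrite htt' -setI_eq0 setIid.
  by move/eqP/setP/(_ (f (inr (t', false)))); rewrite !inE eqxx.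
exists phi, [set h t | t : 'I_m], [set f (inl (u, false)) | u : 'I_M * 'I_k]; split.
- move=> [[j x] y] [[j' x'] y'] /setP e.
  have := e (f (inl (j, x, false))); have := e (f (inl (j, y, true))).
  rewrite !inE !feq !eqxx /= orbT /=; case/esym/orP=> /eqP // [_ ->].
  by case/esym/orP=> [/eqP[-> ->]|/eqP[]].
- by move=> u; rewrite cards2 feq; case: eqP => // -[].
- move=> [[j x] y] [[j' x'] y'] uv uvA; rewrite disjoint_set2 !feq /=.
  apply/and4P; split; apply/eqP => -[] // jj' xx'.
    by move: uv uvA; rewrite /cell_adj /= jj' xx' !eqxx !xpair_eqE !eqxx /=; case: (y == y').
  by move: uv uvA; rewrite /cell_adj /= jj' xx' !eqxx !xpair_eqE !eqxx /=; case: (x == x').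
- by apply: leq_trans (leq_imset_card _ _) _; rewrite card_prod !card_ord.
- move=> [[j x] y]; apply/negP; rewrite -setI_eq0 => /eqP/setP/(_ (f (inl (j, x, false)))).
  by rewrite !inE eqxx /= imset_f.
- by rewrite card_imset // card_ord.
- by move=> e /imsetP[t _ ->]; rewrite cards2 feq; case: eqP => // -[].
- by move=> e e' /imsetP[t _ ->] /imsetP[t' _ ->] htt'; apply: h_disj; apply: contra_neq htt' => ->.
- by move=> e u /imsetP[t _ ->]; rewrite disjoint_set2 !feq.
Qed.

(** Weak duality of matchings and vertex covers: disjoint sets that meet C do so in distinct
    points. *)
Lemma card_trivIset_hitting (V : finType) (P : {set {set V}}) (C : {set V}) :
  finset.trivIset P -> (forall e, e \in P -> ~~ [disjoint e & C]) -> (#|P| <= #|C|)%N.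
Proof.
move=> tP PC; pose F x : nat := x \in C.
have e := @big_trivIset _ _ 0%N addn P F tP.
apply: (@leq_trans (\sum_(A in P) \sum_(x in A) F x)%N).
  rewrite -sum1_card; apply: leq_sum => A AP.
  have := PC A AP; rewrite -setI_eq0 => /set0Pn[x]; rewrite inE => /andP[xA xC].
  by rewrite (bigD1 x) //= /F xC.
rewrite -e -sum1_card big_mkcond [leqRHS]big_mkcond; apply: leq_sum => x _.
by rewrite /F; case: ifP; case: ifP.
Qed.

Definition color_class (V : finType) (k : nat) (E : {set {set V}})
    (g : {ffun {set V} -> 'I_k}) (i : 'I_k) : {set {set V}} :=
  [set e in E | g e == i].

Definition template_graph (V : finType) (M k : nat) (phi : 'I_M * 'I_k * 'I_k -> {set V})
    (H : {set {set V}}) : {set {set V}} :=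
  H :|: [set phi u | u : 'I_M * 'I_k * 'I_k].

Lemma hidden_isolated (V : finType) (M k m l : nat) (phi : 'I_M * 'I_k * 'I_k -> {set V})
    (H : {set {set V}}) (C : {set V}) (g : {ffun {set V} -> 'I_l}) (i : 'I_l) :
  hard_template m phi H C ->
  color_class H g i \subset isolated_edges (color_class (template_graph phi H) g i).
Proof.
move=> tpl; apply/subsetP => e; rewrite inE => /andP[eH gi].
rewrite !inE eH gi /= (card_hidden_edge tpl eH) eqxx /=.
apply/forall_inP => e'; rewrite !inE => /andP[e'E _]; apply/implyP => e'e.
case/orP: e'E => [e'H|/imsetP[u _ ->]]; last exact: (hidden_cell_disjoint tpl).
by apply: (hidden_disjoint tpl) => //; rewrite eq_sym.
Qed.

Lemma lone_isolated (V : finType) (M k m l : nat) (phi : 'I_M * 'I_k * 'I_k -> {set V})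
    (H : {set {set V}}) (C : {set V}) (g : {ffun {set V} -> 'I_l}) (i : 'I_l) :
  hard_template m phi H C ->
  phi @: [set u | lone phi i g u] \subset
    isolated_edges (color_class (template_graph phi H) g i).
Proof.
move=> tpl; apply/subsetP => e /imsetP[u + ->{e}]; rewrite inE => /andP[gi /forallP glone].
rewrite !inE imset_f ?inE // gi orbT /= (card_cell tpl) eqxx /=.
apply/forall_inP => e'; rewrite !inE => /andP[e'E gi']; apply/implyP => e'u.
case/orP: e'E e'u gi' => [e'H _ _|/imsetP[v _ ->] vu gv].
  by rewrite disjoint_sym; apply: (hidden_cell_disjoint tpl).
apply: (cell_disjoint tpl); first by apply: contra_neq vu => ->.
by apply/negP => /(implyP (glone v)); rewrite gv.
Qed.

Lemma template_simple (V : finType) (M k m : nat) (phi : 'I_M * 'I_k * 'I_k -> {set V})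
    (H : {set {set V}}) (C : {set V}) (sigma : {perm V}) :
  hard_template m phi H C -> simple_graph (relabel sigma (template_graph phi H)).
Proof.
move=> tpl; apply/forall_inP => e /imsetP[e' e'E ->].
rewrite card_imset; last exact: perm_inj.
move: e'E; rewrite inE => /orP[/(card_hidden_edge tpl) -> //|/imsetP[u _ ->]].
by rewrite (card_cell tpl).
Qed.

Lemma template_matching (V : finType) (M k m : nat) (phi : 'I_M * 'I_k * 'I_k -> {set V})
    (H : {set {set V}}) (C : {set V}) (sigma : {perm V}) :
  hard_template m phi H C -> (m <= MM (relabel sigma (template_graph phi H)))%N.
Proof.
move=> tpl; rewrite -(card_hidden tpl) -(card_relabel sigma H) /MM.
apply: (@leq_bigmax_cond _ (matching _) (fun N : {set {set V}} => #|N|)).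
apply/andP; split; first by apply: imsetS; apply: subsetUl.
apply/trivIsetP => _ _ /imsetP[e eH ->] /imsetP[e' e'H ->] ee'.
rewrite imset_disjoint; first by apply: (hidden_disjoint tpl) => //; apply: contra_neq ee' => ->.
exact: perm_inj.
Qed.

(** A matching of the union splits into images of cells, at most Mk of them since C covers the
    cells, and images of hidden edges that some coreset has kept. *)
Lemma template_MM_union_le (V : finType) (M k m l : nat) (phi : 'I_M * 'I_k * 'I_k -> {set V})
    (H : {set {set V}}) (C : {set V}) (sigma : {perm V}) (g : {ffun {set V} -> 'I_l})
    (alg : {set {set V}} -> {set {set V}})
    (G := fun i => relabel sigma (color_class (template_graph phi H) g i)) :
  hard_template m phi H C -> (forall i, alg (G i) \subset G i) ->
  (MM (\bigcup_(i < l) alg (G i)) <=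
     \sum_(i < l) #|[set e in color_class H g i | sigma @: e \in alg (G i)]| + M * k)%N.
Proof.
move=> tpl algG; apply/bigmax_leqP => N /andP[NU Ntriv].
pose F := relabel sigma [set phi u | u : 'I_M * 'I_k * 'I_k].
rewrite -(cardsID F N) addnC; apply: leq_add; last first.
  apply: leq_trans (card_cover tpl).
  rewrite -(card_imset C (@perm_inj _ sigma)); apply: card_trivIset_hitting.
    exact: finset.trivIsetS (subsetIl _ _) Ntriv.
  move=> e; rewrite inE => /andP[_ /imsetP[_ /imsetP[u _ ->] ->]].
  rewrite imset_disjoint; first exact: (cell_cover tpl).
  exact: perm_inj.
pose S i := [set e in color_class H g i | sigma @: e \in alg (G i)].
apply: (@leq_trans #|\bigcup_(i < l) relabel sigma (S i)|); last first.
  elim/big_ind2: _ => [|A a B b Aa Bb|i _]; rewrite ?cards0 ?card_relabel //.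
  by apply: leq_trans (leq_add Aa Bb); rewrite cardsU leq_subr.
apply/subset_leq_card/subsetP => e; rewrite inE => /andP[eF eN].
have /bigcupP[i _ eA] := subsetP NU e eN.
have /imsetP[e' e'G eE] := subsetP (algG i) e eA.
apply/bigcupP; exists i => //; rewrite eE; apply: imset_f.
move: e'G; rewrite !inE -eE eA andbT => /andP[/orP[-> //|e'F] _].
by case/negP: eF; rewrite eE imset_f.
Qed.

(** * From labellings of the edges to colorings of all vertex sets *)

(* Coloring all vertex sets instead of the edges of E gives a sample space that does
   not depend on E, so that relabelled graphs can be compared. *)
Definition restrict_coloring (V : finType) (k : nat) (E : {set {set V}})
    (g : {ffun {set V} -> 'I_k}) : edge_partition k E :=
  [ffun e : {e : {set V} | e \in E} => g (val e)].

Lemma part_restrict (V : finType) (k : nat) (E : {set {set V}})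
    (g : {ffun {set V} -> 'I_k}) (i : 'I_k) :
  part (restrict_coloring E g) i = color_class E g i.
Proof.
apply/setP => e; rewrite inE; apply/imsetP/andP => [[x]|[eE gi]].
  by rewrite inE ffunE => gi ->; split=> //; apply: valP.
by exists (Sub e eE); rewrite // inE ffunE.
Qed.

(** Restriction to E has fibers of one common size c, because the colors outside E are free; so it
    carries the uniform distribution to the uniform distribution. *)
Lemma Pr_partition_coloring (R : realType) (V : finType) (k : nat) (E : {set {set V}})
    (A : pred (edge_partition k E)) : (0 < k)%N ->
  \sum_(g : {ffun {set V} -> 'I_k}) (A (restrict_coloring E g))%:R =
  #|{ffun {set V} -> 'I_k}|%:R * Pr_partition R A.
Proof.
move=> k_gt0.
pose c := (\prod_(e : {set V}) if e \in E then 1 else k)%N.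
have fiber (f : edge_partition k E) :
    #|[set g : {ffun {set V} -> 'I_k} | restrict_coloring E g == f]| = c.
  pose P (e : {set V}) : pred 'I_k :=
    if insub e is Some x then pred1 (f x) else predT.
  transitivity #|family P|.
    apply: eq_card => g; rewrite inE; apply/eqP/familyP => [gf e|gP].
      by rewrite /P; case: insubP => [x _ <-|//]; rewrite inE -gf ffunE.
    apply/ffunP => x; rewrite ffunE; have := gP (val x).
    by rewrite /P valK inE => /eqP.
  rewrite card_family foldrE big_map big_enum /=; apply: eq_bigr => e _.
  rewrite /P; case: insubP => [x -> _|/negPf ->]; first by rewrite card1.
  by rewrite card_ord.
have count (B : pred (edge_partition k E)) :
    \sum_(g : {ffun {set V} -> 'I_k}) (B (restrict_coloring E g))%:R =
    #|[set f | B f]|%:R * c%:R :> R.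
  rewrite (partition_big (restrict_coloring E) predT) //=.
  rewrite natr_card_set mulr_suml; apply: eq_bigr => f _.
  rewrite -(fiber f) natr_card_set mulr_sumr big_mkcond; apply: eq_bigr => g _.
  by case: eqP => [->|_]; rewrite ?mulr1 ?mulr0.
have EP_neq0 : #|edge_partition k E|%:R != 0 :> R.
  by rewrite pnatr_eq0 card_ffun card_ord expn_eq0 negb_and -lt0n k_gt0.
(* The total number of colorings is the count for the event that always holds. *)
have -> : #|{ffun {set V} -> 'I_k}|%:R = #|edge_partition k E|%:R * c%:R :> R.
  have := count predT; rewrite /= sumr_const => ->.
  by congr (_%:R * _); apply: eq_card => f; rewrite inE.
by rewrite count /Pr_partition; field.
Qed.

(** * Double counting of the hidden edges kept by the coresets *)

(** With at least mu / 2 lone cells there are that many isolated edges, and the symmetry argument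
    bounds the share of the hidden ones. With fewer, the trivial bound s is paid for by the
    indicator, whose expectation Chebyshev's inequality controls. *)
Lemma sum_selected_color (R : realFieldType) (V : finType) (M k m s : nat)
    (phi : 'I_M * 'I_k * 'I_k -> {set V}) (H : {set {set V}}) (C : {set V})
    (g : {ffun {set V} -> 'I_k}) (i : 'I_k) (alg : {set {set V}} -> {set {set V}})
    (G := color_class (template_graph phi H) g i) (mu : R) :
  hard_template m phi H C -> 0 < mu ->
  (forall sigma : {perm V}, #|alg (relabel sigma G)| <= s)%N ->
  (\sum_(sigma : {perm V})
     #|[set e in color_class H g i | sigma @: e \in alg (relabel sigma G)]|)%:R <=
  #|{perm V}|%:R * (s%:R * (2 / mu * #|color_class H g i|%:R +
                            (#|[set u | lone phi i g u]|%:R < mu / 2)%R%:R)).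
Proof.
move=> tpl mu_gt0 alg_s; set W := (\sum_sigma _)%N.
have [few|many] := ltP #|[set u | lone phi i g u]|%:R (mu / 2).
  apply: (@le_trans _ _ (#|{perm V}|%:R * s%:R)); last first.
    rewrite ler_wpM2l // -[leLHS]mulr1 ler_wpM2l // lerDr.
    by rewrite mulr_ge0 // divr_ge0 // ltW.
  rewrite -natrM ler_nat /W -sum_nat_const; apply: leq_sum => sigma _.
  apply: leq_trans (alg_s sigma).
  rewrite -(card_imset _ (@imset_perm_inj _ sigma)); apply: subset_leq_card.
  by apply/subsetP => y /imsetP[e eA ->{y}]; move: eA; rewrite inE => /andP[].
have lone_I : (#|[set u | lone phi i g u]| <= #|isolated_edges G|)%N.
  rewrite -(card_imset _ (cell_inj tpl)).
  exact: subset_leq_card (lone_isolated g i tpl).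
have := sum_selected_isolated alg_s (hidden_isolated g i tpl).
rewrite -/W -(ler_nat R) !natrM => WI.
rewrite addr0 -(ler_pM2l (_ : 0 < mu / 2)); last by rewrite divr_gt0.
have -> : mu / 2 * (#|{perm V}|%:R * (s%:R * (2 / mu * #|color_class H g i|%:R))) =
   #|color_class H g i|%:R * (s%:R * #|{perm V}|%:R).
  by field; rewrite gt_eqF.
apply: le_trans WI; rewrite ler_wpM2r //.
by apply: le_trans many _; rewrite ler_nat.
Qed.

(** Transport along sigma is a bijection of the sample space, so for fixed sigma the parts of the
    relabelled graph may be replaced by the relabelled parts of the original graph. *)
Definition push_coloring (V : finType) (k : nat) (sigma : {perm V})
    (g : {ffun {set V} -> 'I_k}) : {ffun {set V} -> 'I_k} :=
  [ffun e : {set V} => g (sigma^-1%g @: e)].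

Lemma push_coloring_inj (V : finType) (k : nat) (sigma : {perm V}) :
  injective (@push_coloring V k sigma).
Proof.
move=> g h gh; apply/ffunP => e; have := congr1 (fun f : {ffun _ -> _} => f (sigma @: e)) gh.
by rewrite !ffunE -!imset_permM mulgV (eq_imset _ (@perm1 V)) imset_id.
Qed.

Lemma color_class_push (V : finType) (k : nat) (sigma : {perm V}) (E : {set {set V}})
    (g : {ffun {set V} -> 'I_k}) (i : 'I_k) :
  color_class (relabel sigma E) (push_coloring sigma g) i = relabel sigma (color_class E g i).
Proof.
apply/setP => e; rewrite inE ffunE; apply/andP/imsetP => [[/imsetP[e' e'E ->]]|[e' + ->]].
  rewrite -imset_permM mulgV (eq_imset _ (@perm1 V)) imset_id => gi.
  by exists e' => //; rewrite inE e'E.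
rewrite inE => /andP[e'E gi].
by rewrite imset_f // -imset_permM mulgV (eq_imset _ (@perm1 V)) imset_id.
Qed.

Lemma coreset_tradeoff (R : realType) (V : finType) (M k m s : nat) (a : R)
    (alg : {set {set V}} -> {set {set V}})
    (mu := (M * k)%:R * (1 - k%:R^-1) ^+ (2 * k.-1) : R) :
  (0 < M)%N -> (1 < k)%N -> (2 * (M * k) + 2 * m <= #|V|)%N -> 0 < a ->
  (M * k)%:R <= m%:R / (2 * a) ->
  (forall E, simple_graph E -> (alg E \subset E) && (#|alg E| <= s)%N) ->
  (forall E, simple_graph E -> 1 / 2 <= Pr_partition R (fun f : edge_partition k E =>
     (MM E)%:R / a <= (MM (\bigcup_(i < k) alg (part f i)))%:R)) ->
  m%:R * mu <= 4 * a * s%:R * (2 * m%:R + 4 * k%:R).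
Proof.
move=> M_gt0 k_gt1 V_large a_gt0 Mk_le alg_sub alg_pr.
have k_gt0 := ltnW k_gt1.
have mu_gt0 : 0 < mu.
  rewrite mulr_gt0 ?ltr0n ?muln_gt0 ?M_gt0 // exprn_gt0 // subr_gt0.
  by rewrite invf_lt1 ?ltr0n ?ltr1n.
have [phi [H [C tpl]]] := hard_template_exists V_large.
pose E0 := template_graph phi H.
pose Om := #|{ffun {set V} -> 'I_k}|%:R : R.
pose Sn := #|{perm V}|%:R : R.
have Om_gt0 : 0 < Om by rewrite ltr0n card_ffun card_ord expn_gt0 k_gt0.
have Sn_gt0 : 0 < Sn by rewrite ltr0n; apply/card_gt0P; exists 1%g.
pose X (sigma : {perm V}) (g : {ffun {set V} -> 'I_k}) (i : 'I_k) :=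
  #|[set e in color_class H g i | sigma @: e \in alg (relabel sigma (color_class E0 g i))]|.
have Gsimple sigma (g : {ffun {set V} -> 'I_k}) i :
    simple_graph (relabel sigma (color_class E0 g i)).
  apply/forall_inP => e /imsetP[e' + ->]; rewrite inE => /andP[e'E _].
  by apply: (forall_inP (template_simple sigma tpl)); apply: imset_f.
(* For each sigma at least half of the colorings succeed, and a successful one keeps at least m/a -
   Mk >= m/(2a) hidden edges. *)
have lower sigma : Om / 2 * (m%:R / (2 * a)) <= \sum_g \sum_(i < k) (X sigma g i)%:R.
  have := alg_pr _ (template_simple sigma tpl).
  rewrite -(ler_pM2l Om_gt0) -Pr_partition_coloring //.
  rewrite (reindex_inj (@push_coloring_inj V k sigma)) /= => pr.
  apply: (@le_trans _ _ (\sum_(g : {ffun {set V} -> 'I_k})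
     ((MM (relabel sigma E0))%:R / a <=
      (MM (\bigcup_(i < k) alg (relabel sigma (color_class E0 g i))))%:R)%R%:R * (m%:R / (2 * a)))).
    rewrite -mulr_suml ler_wpM2r ?divr_ge0 ?mulr_ge0 ?(ltW a_gt0) //.
    move: pr; rewrite mul1r => /le_trans; apply; apply: ler_sum => g _.
    rewrite (eq_bigr (fun i => alg (relabel sigma (color_class E0 g i)))) //.
    by move=> i _; rewrite part_restrict color_class_push.
  apply: ler_sum => g _; case: (boolP ((MM (relabel sigma E0))%:R / a <= _))
    => [succ|_]; last first.
    by rewrite mul0r sumr_ge0.
  rewrite mul1r.
  have algG i : alg (relabel sigma (color_class E0 g i)) \subset relabel sigma (color_class E0 g i).
    by case/andP: (alg_sub _ (Gsimple sigma g i)).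
  have := template_MM_union_le tpl algG; rewrite -/E0 -(ler_nat R) natrD natr_sum => up.
  have : m%:R / a <= (MM (relabel sigma E0))%:R / a.
    by rewrite ler_pM2r ?invr_gt0 // ler_nat (template_matching _ tpl).
  move=> /le_trans/(_ succ)/le_trans/(_ up).
  have -> : m%:R / a = m%:R / (2 * a) + m%:R / (2 * a) by field; rewrite gt_eqF.
  by move: Mk_le; rewrite /X; lra.
(* Here the coloring and the part are fixed first and sigma is averaged, so that the symmetry bound
   applies to each part. *)
have upper : \sum_(sigma : {perm V}) \sum_g \sum_(i < k) (X sigma g i)%:R <=
    Sn * (s%:R * (Om * (2 / mu * m%:R + k%:R * (4 / mu)))).
  apply: (@le_trans _ _ (\sum_(g : {ffun {set V} -> 'I_k}) \sum_(i < k)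
     Sn * (s%:R * (2 / mu * #|color_class H g i|%:R +
                   (#|[set u | lone phi i g u]|%:R < mu / 2)%R%:R)))).
    rewrite exchange_big; apply: ler_sum => g _; rewrite exchange_big; apply: ler_sum => i _.
    rewrite -natr_sum; apply: sum_selected_color tpl mu_gt0 _ => sigma.
    by case/andP: (alg_sub _ (Gsimple sigma g i)).
  under eq_bigr do rewrite -mulr_sumr -mulr_sumr big_split -mulr_sumr /=.
  rewrite -mulr_sumr -mulr_sumr ler_pM2l // ler_wpM2l // big_split /= mulrDr.
  apply: lerD.
    (* The color classes of H partition it, so their sizes add up to m for every coloring. *)
    rewrite (eq_bigr (fun=> 2 / mu * m%:R)); first by rewrite sumr_const -[leLHS]mulr_natl lexx.
    move=> g _; rewrite -(card_hidden tpl) -natr_sum; congr (_ * _%:R).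
    under eq_bigr do rewrite /color_class -sum1dep_card big_mkcondr.
    rewrite exchange_big /= -sum1_card; apply: eq_bigr => e _.
    by rewrite -big_mkcond (big_pred1 (g e)).
  rewrite exchange_big /=; apply: (@le_trans _ _ (\sum_(i < k) Om * (4 / mu))).
    by apply: ler_sum => i _; apply: card_lone_chebyshev (cell_inj tpl) mu_gt0.
  by rewrite sumr_const card_ord -[leLHS]mulr_natl mulrCA lexx.
have := le_trans (ler_sum _ (fun sigma _ => lower sigma)) upper.
rewrite sumr_const -[leLHS]mulr_natl (_ : #|_|%:R = Sn) // ler_pM2l //.
rewrite -mulrA [leRHS]mulrCA ler_pM2l //.
(* What remains is m/(4a) <= s (2m + 4k) / mu; the factor 4 a mu clears the denominators. *)
rewrite -(ler_pM2r (_ : 0 < 4 * a * mu)); last by rewrite pmulr_lgt0 // mulr_gt0.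
by congr (_ <= _); field; rewrite ?gt_eqF.
Qed.

(* Choice of parameters and asymptotics *)
From mathcomp Require Import all_classical all_reals all_analysis.
Import numFieldNormedType.Exports.
Local Open Scope classical_set_scope.

(** The inverse of 1 - 1/k is 1 + 1/(k-1), which is at most exp(1/(k-1)); the power 2(k-1) then
    gives exp(2). *)
Lemma expR_le_pow_onem_inv (R : realType) (k : nat) : (1 < k)%N ->
  expR (- 2) <= (1 - k%:R^-1) ^+ (2 * k.-1) :> R.
Proof.
case: k => [|[|k]] // _; rewrite /=.
have -> : 1 - k.+2%:R^-1 = (1 + k.+1%:R^-1)^-1 :> R.
  rewrite -[k.+2]addn1 natrD; have x_gt0 : 0 < k.+1%:R :> R by [].
  by move: (k.+1%:R : R) x_gt0 => x x_gt0; field; rewrite !gt_eqF ?addr_gt0.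
rewrite exprVn expRN lef_pV2 ?posrE ?expR_gt0 ?exprn_gt0 ?addr_gt0 ?invr_gt0 ?ltr0n //.
have := expR_ge1Dx (k.+1%:R^-1 : R) => h.
apply: le_trans (_ : expR k.+1%:R^-1 ^+ (2 * k.+1) <= _).
  by rewrite lerXn2r // ?nnegrE ?expR_ge0 ?addr_ge0.
rewrite -expRM_natl natrM -mulrA divff ?mulr1 // pnatr_eq0 //.
Qed.

Lemma coreset_size_lower (R : realType) (n k s : nat) (a : R)
    (alg : {set {set 'I_n}} -> {set {set 'I_n}}) :
  (8 <= n)%N -> (0 < k)%N -> 1 <= a -> 64 * a <= n%:R / k%:R -> 64 * a <= k%:R ->
  (forall E, simple_graph E -> (alg E \subset E) && (#|alg E| <= s)%N) ->
  (forall E, simple_graph E -> 1 / 2 <= Pr_partition R (fun f : edge_partition k E =>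
     (MM E)%:R / a <= (MM (\bigcup_(i < k) alg (part f i))%SET)%:R)) ->
  expR (- 2) / (512 * 20) * (n%:R / a ^+ 2) <= s%:R.
Proof.
move=> n8 k_gt0 a1 ank ak alg_sub alg_pr.
have a_gt0 : 0 < a by lra.
have kR_gt0 : 0 < k%:R :> R by rewrite ltr0n.
have k_gt1 : (1 < k)%N by rewrite -(ltr_nat R); lra.
rewrite ler_pdivlMr // in ank.
set N := n%:R in ank *.
have N8 : 8 <= N by rewrite ler_nat.
have kN : k%:R <= N by nra.
set m := (n %/ 4)%N.
have m_up : 4 * m%:R <= N by rewrite -natrM ler_nat mulnC leq_divM.
have m_lo : N <= 8 * m%:R by rewrite -natrM ler_nat /m; lia.
(* The constant 32 gives Mk <= n/(32a) <= m/(2a), using n <= 8m. Since 64 a k <= n, x is at least 2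
   and rounding down loses at most a factor 2. *)
pose x := N / (32 * a * k%:R); pose M := Num.truncn x.
have ak_gt0 : 0 < 32 * a * k%:R by rewrite !mulr_gt0.
have x2 : 2 <= x by rewrite ler_pdivlMr //; nra.
have /andP[Mx xM] : M%:R <= x < M.+1%:R by apply: truncn_itv; lra.
have M_lo : x / 2 <= M%:R by rewrite -natr1 in xM; lra.
have M_gt0 : (0 < M)%N by rewrite -(ltr_nat R); lra.
have xE : x * k%:R = N / (32 * a) by rewrite /x; field; rewrite !gt_eqF.
have Mk_up : (M * k)%:R <= N / (32 * a) by rewrite -xE natrM ler_pM2r.
have Mk_lo : N / (32 * a) / 2 <= (M * k)%:R.
  by rewrite -xE natrM mulrAC ler_pM2r.
have Na : N / (32 * a) <= N / 32.
  by rewrite ler_pM2l ?lef_pV2 ?posrE; lra.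
have V_large : (2 * (M * k) + 2 * m <= #|'I_n|)%N.
  by rewrite card_ord -(ler_nat R) natrD !(natrM _ 2%N) -/N; lra.
have Mk_le : (M * k)%:R <= m%:R / (2 * a).
  apply: le_trans Mk_up _; rewrite ler_pdivrMr ?mulr_gt0 //.
  have -> : m%:R / (2 * a) * (32 * a) = 16 * m%:R by field; rewrite gt_eqF.
  lra.
have := coreset_tradeoff M_gt0 k_gt1 V_large a_gt0 Mk_le alg_sub alg_pr.
have := expR_le_pow_onem_inv R k_gt1; have := expR_gt0 (- 2 : R).
set c := expR _; set q := _ ^+ _ => c_gt0 cq main.
have N_gt0 : 0 < N by lra.
have t_ge0 : 0 <= N / (32 * a) / 2 by rewrite !divr_ge0 ?mulr_ge0 ?ltW.
have mu_lo : N / (32 * a) / 2 * c <= (M * k)%:R * q.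
  by apply: ler_pM => //; apply: ltW.
have lo : N / 8 * (N / (32 * a) / 2 * c) <= m%:R * ((M * k)%:R * q).
  apply: ler_pM => //; first by rewrite divr_ge0 ?ltW.
    by apply: mulr_ge0 => //; apply: ltW.
  by rewrite ler_pdivrMr // mulrC.
have hi : 4 * a * s%:R * (2 * m%:R + 4 * k%:R) <= 4 * a * s%:R * (5 * N).
  rewrite ler_wpM2l // ?mulr_ge0 ?(ltW a_gt0) //.
  by move: m_up kN N_gt0; clear; lra.
(* The constant arises here: 512 = 8 * 32 * 2 comes from the lower bounds on m and Mk, and 20 = 4 *
   5 from 2m + 4k <= 5n. *)
have := le_trans (le_trans lo main) hi.
have f_gt0 : 0 < N * (20 * a) by rewrite !mulr_gt0.
rewrite -(ler_pM2l f_gt0 (c / _ * _)).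
by congr (_ <= _); field; rewrite ?gt_eqF.
Qed.

Lemma matching_subset_MM (V : finType) (E F : {set {set V}}) :
  E \subset F -> (MM E <= MM F)%N.
Proof.
move=> EF; apply/bigmax_leqP => N /andP[NE Nt].
apply: (@leq_bigmax_cond _ (matching _) (fun N : {set {set V}} => #|N|)).
by rewrite /matching (fintype.subset_trans NE EF).
Qed.

(** On a graph with a single edge some partition succeeds, and the union of its coresets is a
    subgraph, so its matching cannot beat the optimum. This turns positivity of the ratio into the
    bound 1 <= a on which the choice of M relies. *)
Lemma approximation_ratio_ge1 (R : realType) (n k s : nat) (a : R)
    (alg : {set {set 'I_n}} -> {set {set 'I_n}}) :
  (2 <= n)%N -> 0 < a ->
  (forall E, simple_graph E -> (alg E \subset E) && (#|alg E| <= s)%N) ->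
  (forall E, simple_graph E -> 1 / 2 <= Pr_partition R (fun f : edge_partition k E =>
     (MM E)%:R / a <= (MM (\bigcup_(i < k) alg (part f i))%SET)%:R)) ->
  1 <= a.
Proof.
case: n alg => [|[|n]] // alg _ a_gt0 alg_sub alg_pr.
pose e : {set 'I_n.+2} := [set ord0; ord_max]%SET.
have e2 : #|e| = 2%N by rewrite cards2.
have E_simple : simple_graph [set e]%SET.
  by apply/forall_inP => e'; rewrite inE => /eqP ->; rewrite e2.
have MM_gt0 : (0 < MM [set e]%SET)%N.
  apply: leq_trans (_ : #|[set e]%SET| <= _)%N; first by rewrite cards1.
  apply: (@leq_bigmax_cond _ (matching _) (fun N : {set {set _}} => #|N|)).
  by rewrite /matching fintype.subxx finset.trivIset1.
have := alg_pr _ E_simple; rewrite /Pr_partition; set S := [set f | _]%SET.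
have [->|[f fS]] := set_0Vmem S; first by rewrite cards0 mul0r; lra.
move=> _; move: fS; rewrite inE ler_pdivrMr // => h.
have U_sub : ((\bigcup_(i < k) alg (part f i)) \subset [set e])%SET.
  apply/finset.bigcupsP => i _.
  have part_sub : (part f i \subset [set e])%SET.
    by apply/fintype.subsetP => x /imsetP[y _ ->]; apply: valP.
  apply: (fintype.subset_trans _ part_sub); have [|//] := andP (alg_sub (part f i) _).
  by apply/forall_inP => x /(fintype.subsetP part_sub) xe; apply: (forall_inP E_simple).
have := matching_subset_MM U_sub; rewrite -(ler_nat R) => U_le.
rewrite -(ler_pM2l (_ : 0 < (MM [set e]%SET)%:R)) ?ltr0n // mulr1.
by apply: le_trans h _; rewrite ler_pM2r.
Qed.

Theorem theorem3 (R : realType) (k : nat -> nat) (alpha : nat -> R)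
    (s : nat -> nat) (ALG : graph_algorithm)
    (k_gt0 : forall n : nat, (0 < k n)%N)
    (alpha_gt0 : forall n : nat, 0 < alpha n)
    (k_small : (fun n : nat => (k n)%:R : R^o) =o_\oo
                 (fun n : nat => n%:R / ln n%:R : R^o))
    (alpha_small : (alpha : nat -> R^o) =o_\oo
                 (fun n : nat => Num.min (n%:R / (k n)%:R) (k n)%:R : R^o))
    (ALG_coreset : randomized_composable_coreset k alpha s ALG) :
  (fun n : nat => (s n)%:R : R^o) \is 'Omega_\oo
    (fun n : nat => n%:R / alpha n ^+ 2 : R^o).
Proof.
have [ALG_sub ALG_pr] := ALG_coreset.
(* The little-o bound is taken with constant 1/64, matching the factor 64 of
   [coreset_size_lower]. *)
have alpha_le : \forall n \near \oo, 64 * alpha n <= Num.min (n%:R / (k n)%:R) (k n)%:R.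
  have /eqoP/(_ 64^-1) := alpha_small; rewrite invr_gt0 => /(_ ltac:(by [])).
  apply: filterS => n; rewrite (ger0_norm (ltW (alpha_gt0 n))) ger0_norm.
    by rewrite ler_pdivlMl.
  by rewrite le_min divr_ge0 /=.
apply/asboolP; exists (expR (- 2) / (512 * 20)); first by apply: divr_gt0; [exact: expR_gt0 | rewrite mulr_gt0 ?ltr0n].
near=> n.
have n8 : (8 <= n)%N by near: n; exact: nbhs_infty_ge.
have pr : forall E : {set {set 'I_n}}, simple_graph E ->
    1 / 2 <= Pr_partition R (fun f : edge_partition (k n) E =>
      (MM E)%:R / alpha n <= (MM (\bigcup_(i < k n) ALG n (part f i))%SET)%:R).
  (* Of high probability only the case of failure probability 1/2 is used. *)
  rewrite (_ : 1 / 2 = 1 - 2^-1 :> R); last by field.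
  by near: n; apply: ALG_pr; rewrite invr_gt0.
have := near alpha_le n; rewrite le_min => /(_ _)/andP[//|ank ak].
have a1 := approximation_ratio_ge1 (leq_trans (isT : 2 <= 8)%N n8) (alpha_gt0 n) (ALG_sub n) pr.
rewrite /= ger0_norm ?divr_ge0 ?sqr_ge0 // ger0_norm //.
exact: (coreset_size_lower n8 (k_gt0 n) a1 ank ak (ALG_sub n) pr).
Unshelve. all: by end_near.
Qed.
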